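(* Consider the higher order Camassa–Holm equation $\Delta[u]=0$, where $$\Delta[U]=U_t-U_{xxt}+U_{xxxxt}+3UU_x-2U_xU_{xx}-UU_{xxx}+2U_xU_{xxxx}+UU_{xxxxx}.$$ A function $\xi(x,t,U)$ is a local conservation law multiplier of this equation, that is, the identity $$E_U\big[\xi(x,t,U)\,\Delta[U]\big]\equiv 0$$ holds for arbitrary functions $U(x,t)$, if and only if $$\xi=c_1U+c_2$$ for some arbitrary constants $c_1,c_2$.
   Context: $U(x,t)$ is an arbitrary smooth real function of two real variables, and $\xi$ is a smooth real function of $(x,t,U)\in\mathbb R^3$. $D_x,D_t$ denote total derivatives with respect to $x,t$. The Euler operator with respect to $U$ is $$E_U=\sum_{a,b\ge 0}(-1)^{a+b}D_x^aD_t^b\,\frac{\partial}{\partial U_{x^at^b}},$$ where $U_{x^at^b}=\partial_x^a\partial_t^bU$. It is applied to differential functions, i.e. smooth functions of $x,t,U$ and finitely many derivatives of $U$ regarded as independent coordinates. *)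

(* Defs.v *)
From Stdlib Require Import Reals.
From Coquelicot Require Import Coquelicot.
Open Scope R_scope.

(* C^k regularity, by recursion on k: the function is jointly continuous and
   its first partial derivatives exist everywhere and are C^(k-1). *)
Fixpoint C_k2 (k : nat) (f : R -> R -> R) : Prop :=
  (forall x t, continuity_2d_pt f x t) /\
  match k with
  | O => True
  | S k' =>
      (forall x t, ex_derive (fun s => f s t) x) /\
      (forall x t, ex_derive (fun s => f x s) t) /\
      C_k2 k' (fun x t => Derive (fun s => f s t) x) /\
      C_k2 k' (fun x t => Derive (fun s => f x s) t)
  end.

Definition smooth2 (f : R -> R -> R) : Prop := forall k, C_k2 k f.

Fixpoint C_k3 (k : nat) (f : R -> R -> R -> R) : Prop :=
  (forall x t u,
     continuous (fun p : R * R * R => f (fst (fst p)) (snd (fst p)) (snd p))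
                (x, t, u)) /\
  match k with
  | O => True
  | S k' =>
      (forall x t u, ex_derive (fun s => f s t u) x) /\
      (forall x t u, ex_derive (fun s => f x s u) t) /\
      (forall x t u, ex_derive (fun s => f x t s) u) /\
      C_k3 k' (fun x t u => Derive (fun s => f s t u) x) /\
      C_k3 k' (fun x t u => Derive (fun s => f x s u) t) /\
      C_k3 k' (fun x t u => Derive (fun s => f x t s) u)
  end.

Definition smooth3 (f : R -> R -> R -> R) : Prop := forall k, C_k3 k f.

(* A point of the infinite jet space: x, t, and the coordinates
   [ju a b] = U_{x^a t^b}, all of them independent. *)
Record jet := Jet { jx : R; jt : R; ju : nat -> nat -> R }.

Definition set_x (s : R) (j : jet) : jet := Jet s (jt j) (ju j).
Definition set_t (s : R) (j : jet) : jet := Jet (jx j) s (ju j).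
Definition set_u (a b : nat) (s : R) (j : jet) : jet :=
  Jet (jx j) (jt j)
      (fun a' b' => if andb (Nat.eqb a' a) (Nat.eqb b' b) then s else ju j a' b').

Definition pd_x (F : jet -> R) (j : jet) : R :=
  Derive (fun s => F (set_x s j)) (jx j).
Definition pd_t (F : jet -> R) (j : jet) : R :=
  Derive (fun s => F (set_t s j)) (jt j).
Definition pd_u (a b : nat) (F : jet -> R) (j : jet) : R :=
  Derive (fun s => F (set_u a b s j)) (ju j a b).

(* The operators below are meant for differential functions, which depend
   smoothly on x, t and finitely many of the [ju a b]: then [pd_u a b F] is
   identically 0 for all but finitely many (a, b), and every double series is
   a finite sum. *)
Definition total_x (F : jet -> R) (j : jet) : R :=
  pd_x F j
  + Series (fun a => Series (fun b => ju j (S a) b * pd_u a b F j)).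
Definition total_t (F : jet -> R) (j : jet) : R :=
  pd_t F j
  + Series (fun a => Series (fun b => ju j a (S b) * pd_u a b F j)).

Definition euler (F : jet -> R) (j : jet) : R :=
  Series (fun a => Series (fun b =>
    (-1) ^ (a + b) * Nat.iter a total_x (Nat.iter b total_t (pd_u a b F)) j)).

(* The jet at (x, t) of a function U; [partial_derive a b U] is
   d^a/dx^a d^b/dt^b U. *)
Definition jet_of (U : R -> R -> R) (x t : R) : jet :=
  Jet x t (fun a b => partial_derive a b U x t).

Definition HOCH (j : jet) : R :=
  let u := ju j in
  u 0%nat 1%nat - u 2%nat 1%nat + u 4%nat 1%nat
  + 3 * u 0%nat 0%nat * u 1%nat 0%nat
  - 2 * u 1%nat 0%nat * u 2%nat 0%nat
  - u 0%nat 0%nat * u 3%nat 0%nat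
  + 2 * u 1%nat 0%nat * u 4%nat 0%nat
  + u 0%nat 0%nat * u 5%nat 0%nat.

Definition local_multiplier (Delta : jet -> R) (xi : R -> R -> R -> R) : Prop :=
  forall U : R -> R -> R, smooth2 U ->
  forall x t : R,
    euler (fun j => xi (jx j) (jt j) (ju j 0%nat 0%nat) * Delta j)
          (jet_of U x t) = 0.

(* Main.v *)
Require Import Defs.
From Stdlib Require Import Reals Lra Lia ZArith FunctionalExtensionality.
From Coquelicot Require Import Coquelicot.
Open Scope R_scope.

(** Since every finitely supported jet is the jet of a polynomial, the multiplier
    equation is a polynomial identity in the independent coordinates [U_ab], with
    coefficients built from the partial derivatives of [xi].
    The coefficient of [U_xxxt] is [-4 (xi_xU + xi_UU U_x)], so
    [xi = a(t) U + b(x,t)].  Then the coefficient of [U_xxxx] gives [b_x = a'],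
    that of [U_xx] gives [b_x = - a'], and what remains is [- b_t = 0]. *)

(** * Finite double series *)

Lemma Series_finite (f : nat -> R) (N : nat) :
  (forall n, (N < n)%nat -> f n = 0) -> Series f = sum_f_R0 f N.
Proof.
  intros Hf; apply is_series_unique, is_lim_seq_Reals.
  intros eps Heps; exists N; intros n Hn.
  rewrite sum_n_Reals; replace (sum_f_R0 f n) with (sum_f_R0 f N).
  { now unfold Rdist; rewrite Rminus_diag, Rabs_R0. }
  induction Hn as [|n Hn IH]; [reflexivity|].
  simpl; rewrite <- IH, Hf by lia; ring.
Qed.

Lemma Series_double_finite (f : nat -> nat -> R) (N : nat) :
  (forall a b, (N < a \/ N < b)%nat -> f a b = 0) ->
  Series (fun a => Series (f a)) = sum_f_R0 (fun a => sum_f_R0 (f a) N) N.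
Proof.
  intros Hf; rewrite (Series_finite _ N).
  - apply sum_eq; intros a _; apply Series_finite; intros b Hb; apply Hf; auto.
  - intros a Ha; rewrite (Series_finite _ 0); simpl; intros; apply Hf; auto.
Qed.

Definition dsum (N : nat) (f : nat -> nat -> R) : R :=
  sum_f_R0 (fun a => sum_f_R0 (f a) N) N.

Lemma dsum_ext N f g : (forall a b, f a b = g a b) -> dsum N f = dsum N g.
Proof. intros H; apply sum_eq; intros; apply sum_eq; intros; apply H. Qed.

Lemma dsum_plus N f g : dsum N (fun a b => f a b + g a b) = dsum N f + dsum N g.
Proof.
  unfold dsum; rewrite <- plus_sum; apply sum_eq; intros; apply plus_sum.
Qed.

Lemma dsum_scal N c f : dsum N (fun a b => f a b * c) = dsum N f * c.
Proof.
  unfold dsum; rewrite (Rmult_comm _ c), scal_sum; apply sum_eq; intros.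
  rewrite (Rmult_comm _ c), scal_sum; reflexivity.
Qed.

Lemma sum_single (N p : nat) (f : nat -> R) :
  (p <= N)%nat -> (forall n, n <> p -> f n = 0) -> sum_f_R0 f N = f p.
Proof.
  intros Hp Hf; induction N as [|N IH].
  - now replace p with 0%nat by lia.
  - simpl; destruct (Nat.eq_dec p (S N)) as [->|Hne].
    + rewrite sum_eq_R0; [ring|]; intros n Hn; apply Hf; lia.
    + rewrite IH, (Hf (S N)) by lia; ring.
Qed.

Lemma dsum_single (N p q : nat) (f : nat -> nat -> R) :
  (p <= N)%nat -> (q <= N)%nat ->
  (forall a b, a <> p \/ b <> q -> f a b = 0) -> dsum N f = f p q.
Proof.
  intros Hp Hq Hf; unfold dsum; rewrite (sum_single N p).
  - apply sum_single; auto.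
  - assumption.
  - intros a Ha; apply sum_eq_R0; auto.
Qed.

(** * Differential functions as syntax *)

(* [Par i j k] stands for the partial derivative [d_x^i d_t^j d_U^k xi] evaluated
   at [(x, t, U)], and [Var a b] for the jet coordinate [U_ab]. *)
Inductive dfun : Set :=
| Cst (z : Z)
| Par (i j k : nat)
| Var (a b : nat)
| Add (e f : dfun)
| Mul (e f : dfun).

(** The symbols [Par] are read in an arbitrary family [X], so the symbolic calculus rests only on
    the coherence of that family. *)
Fixpoint ev (X : nat -> nat -> nat -> R -> R -> R -> R) (e : dfun) (p : jet) : R :=
  match e with
  | Cst z => IZR z
  | Par i j k => X i j k (jx p) (jt p) (ju p 0%nat 0%nat)
  | Var a b => ju p a b
  | Add e f => ev X e p + ev X f p
  | Mul e f => ev X e p * ev X f p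
  end.

(** Here and in [mul], neutral and absorbing constants are removed during construction. This keeps
    iterated derivatives small and turns many vanishing derivatives into the literal [Cst 0]. *)
Definition add (e f : dfun) : dfun :=
  match e, f with
  | Cst 0, _ => f
  | _, Cst 0 => e
  | _, _ => Add e f
  end.

Definition mul (e f : dfun) : dfun :=
  match e, f with
  | Cst 0, _ | _, Cst 0 => Cst 0
  | Cst 1, _ => f
  | _, Cst 1 => e
  | _, _ => Mul e f
  end.

Lemma ev_add X e f p : ev X (add e f) p = ev X e p + ev X f p.
Proof.
  destruct e as [[| |]| | | |], f as [[| |]| | | |]; simpl; ring.
Qed.

Lemma ev_mul X e f p : ev X (mul e f) p = ev X e p * ev X f p.
Proof.
  destruct e as [[|[| |]|]| | | |], f as [[|[| |]|]| | | |]; simpl; ring.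
Qed.

Arguments add : simpl never.
Arguments mul : simpl never.

Fixpoint subst_zero (kX : nat -> nat -> nat -> bool) (kV : nat -> nat -> bool)
  (e : dfun) : dfun :=
  match e with
  | Cst z => Cst z
  | Par i j k => if kX i j k then Par i j k else Cst 0
  | Var a b => if kV a b then Var a b else Cst 0
  | Add e f => add (subst_zero kX kV e) (subst_zero kX kV f)
  | Mul e f => mul (subst_zero kX kV e) (subst_zero kX kV f)
  end.

Lemma ev_subst_zero X kX kV e p :
  (forall i j k, kX i j k = false -> X i j k (jx p) (jt p) (ju p 0%nat 0%nat) = 0) ->
  (forall a b, kV a b = false -> ju p a b = 0) ->
  ev X (subst_zero kX kV e) p = ev X e p.
Proof.
  intros HX HV; induction e as [z|i j k|a b|e IHe f IHf|e IHe f IHf]; simpl.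
  - reflexivity.
  - destruct (kX i j k) eqn:E; simpl; [reflexivity | now rewrite HX].
  - destruct (kV a b) eqn:E; simpl; [reflexivity | now rewrite HV].
  - now rewrite ev_add, IHe, IHf.
  - now rewrite ev_mul, IHe, IHf.
Qed.

(** * Symbolic derivatives in the base and jet directions *)

Inductive dir : Set := dirX | dirT.

Definition shift (d : dir) (a b : nat) : nat * nat :=
  match d with dirX => (S a, b) | dirT => (a, S b) end.

Definition dvar (d : dir) (a b : nat) : dfun :=
  Var (fst (shift d a b)) (snd (shift d a b)).

Definition dpar (d : dir) (i j k : nat) : dfun :=
  Par (fst (shift d i j)) (snd (shift d i j)) k.

(* The explicit derivative, with all jet coordinates held fixed. *)
Fixpoint diff_base (d : dir) (e : dfun) : dfun :=
  match e with
  | Cst _ | Var _ _ => Cst 0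
  | Par i j k => dpar d i j k
  | Add e f => add (diff_base d e) (diff_base d f)
  | Mul e f => add (mul (diff_base d e) f) (mul e (diff_base d f))
  end.

(** A partial derivative of [xi] sees the jet coordinates only through [U_00], hence the test
    against index [(0, 0)]. *)
Fixpoint diff_var (a b : nat) (e : dfun) : dfun :=
  match e with
  | Cst _ => Cst 0
  | Par i j k => if andb (Nat.eqb 0 a) (Nat.eqb 0 b) then Par i j (S k) else Cst 0
  | Var a' b' => if andb (Nat.eqb a' a) (Nat.eqb b' b) then Cst 1 else Cst 0
  | Add e f => add (diff_var a b e) (diff_var a b f)
  | Mul e f => add (mul (diff_var a b e) f) (mul e (diff_var a b f))
  end.

(** The chain rule is applied atom by atom, so no sum over jet coordinates occurs; [ev_diff_total]
    recovers that sum. *)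
Fixpoint diff_total (d : dir) (e : dfun) : dfun :=
  match e with
  | Cst _ => Cst 0
  | Par i j k => add (dpar d i j k) (mul (dvar d 0 0) (Par i j (S k)))
  | Var a b => dvar d a b
  | Add e f => add (diff_total d e) (diff_total d f)
  | Mul e f => add (mul (diff_total d e) f) (mul e (diff_total d f))
  end.

Fixpoint order (e : dfun) : nat :=
  match e with
  | Cst _ | Par _ _ _ => 0
  | Var a b => Nat.max a b
  | Add e f | Mul e f => Nat.max (order e) (order f)
  end.

(** The equality is syntactic, not merely one of values, so that it survives further applications of
    [diff_total]. *)
Lemma diff_var_above_order a b e :
  (order e < a \/ order e < b)%nat -> diff_var a b e = Cst 0.
Proof.
  induction e as [z|i j k|a' b'|e IHe f IHf|e IHe f IHf]; simpl; intros H.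
  - reflexivity.
  - destruct a, b; simpl; try reflexivity; lia.
  - destruct (Nat.eqb_spec a' a), (Nat.eqb_spec b' b); simpl; try reflexivity; lia.
  - rewrite IHe, IHf by lia; reflexivity.
  (* [mul] inspects its first argument first, so [mul e (Cst 0)] reduces only after a case analysis
     on [e]. *)
  - rewrite IHe, IHf by lia; destruct e as [[|[| |]|]| | | |]; reflexivity.
Qed.

(** Since each derivative just raises one index, the symmetry of mixed partial derivatives is built
    into the family. *)
Definition partials_coherent (X : nat -> nat -> nat -> R -> R -> R -> R) : Prop :=
  forall i j k x t u,
    is_derive (fun s => X i j k s t u) x (X (S i) j k x t u) /\
    is_derive (fun s => X i j k x s u) t (X i (S j) k x t u) /\
    is_derive (fun s => X i j k x t s) u (X i j (S k) x t u).

Definition set_base (d : dir) : R -> jet -> jet :=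
  match d with dirX => set_x | dirT => set_t end.
Definition base (d : dir) : jet -> R :=
  match d with dirX => jx | dirT => jt end.
Definition total (d : dir) : (jet -> R) -> jet -> R :=
  match d with dirX => total_x | dirT => total_t end.

Lemma set_u_id a b p : set_u a b (ju p a b) p = p.
Proof.
  destruct p as [x t v]; unfold set_u; simpl; f_equal.
  extensionality a'; extensionality b'.
  destruct (Nat.eqb_spec a' a), (Nat.eqb_spec b' b); subst; reflexivity.
Qed.

Lemma set_base_id d p : set_base d (base d p) p = p.
Proof. destruct d, p; reflexivity. Qed.

Lemma is_derive_Rmult (f g : R -> R) (x df dg : R) :
  is_derive f x df -> is_derive g x dg ->
  is_derive (fun s => f s * g s) x (df * g x + f x * dg).
Proof. intros Hf Hg; apply (is_derive_mult f g x df dg Hf Hg Rmult_comm). Qed.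

Lemma is_derive_Rplus (f g : R -> R) (x df dg : R) :
  is_derive f x df -> is_derive g x dg ->
  is_derive (fun s => f s + g s) x (df + dg).
Proof. apply (is_derive_plus (K := R_AbsRing) (V := R_NormedModule)). Qed.

Lemma is_derive_Rconst (c x : R) : is_derive (fun _ => c) x 0.
Proof. apply (is_derive_const (K := R_AbsRing) (V := R_NormedModule)). Qed.

(** * Soundness of the symbolic derivatives and of the symbolic Euler operator *)

Section Total.

Variable X : nat -> nat -> nat -> R -> R -> R -> R.
Hypothesis HX : partials_coherent X.

Lemma is_derive_ev_base d e p :
  is_derive (fun s => ev X e (set_base d s p)) (base d p) (ev X (diff_base d e) p).
Proof.
  induction e as [z|i j k|a b|e IHe f IHf|e IHe f IHf]; simpl ev.
  - apply is_derive_Rconst.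
  - destruct d; simpl; apply HX.
  - destruct d; simpl; apply is_derive_Rconst.
  - rewrite ev_add; now apply is_derive_Rplus.
  (* The product rule evaluates the factors at [set_base d (base d p) p], which is [p]. *)
  - pose proof (is_derive_Rmult _ _ _ _ _ IHe IHf) as H.
    cbv beta in H; rewrite set_base_id in H; rewrite ev_add, !ev_mul; exact H.
Qed.

Lemma is_derive_ev_var a b e p :
  is_derive (fun s => ev X e (set_u a b s p)) (ju p a b) (ev X (diff_var a b e) p).
Proof.
  induction e as [z|i j k|a' b'|e IHe f IHf|e IHe f IHf]; simpl ev.
  - apply is_derive_Rconst.
  - destruct a, b; simpl; try apply is_derive_Rconst; apply HX.
  - destruct (andb (Nat.eqb a' a) (Nat.eqb b' b)); simpl.
    + apply (is_derive_id (K := R_AbsRing)).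
    + apply is_derive_Rconst.
  - rewrite ev_add; now apply is_derive_Rplus.
  - pose proof (is_derive_Rmult _ _ _ _ _ IHe IHf) as H.
    cbv beta in H; rewrite set_u_id in H; rewrite ev_add, !ev_mul; exact H.
Qed.

Lemma pd_u_ev a b e : pd_u a b (ev X e) = ev X (diff_var a b e).
Proof. extensionality p; apply is_derive_unique, is_derive_ev_var. Qed.

(** By induction on [e], each case being the sum or Leibniz rule. Allowing any [N] above the order
    lets both subterms of a sum or product share one bound. *)
Lemma ev_diff_total d e p N :
  (order e <= N)%nat ->
  ev X (diff_base d e) p
  + dsum N (fun a b => ev X (dvar d a b) p * ev X (diff_var a b e) p)
  = ev X (diff_total d e) p.
Proof.
  induction e as [z|i j k|a b|e IHe f IHf|e IHe f IHf]; intros Hle.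
  - simpl; rewrite (dsum_single N 0 0); simpl; intros; try lia; ring.
  - simpl diff_total; rewrite ev_add, ev_mul; f_equal.
    rewrite (dsum_single N 0 0); simpl; intros; try lia; [reflexivity|].
    destruct a, b; simpl; try ring; lia.
  - simpl in Hle |- *; rewrite (dsum_single N a b); simpl; intros; try lia.
    + rewrite !Nat.eqb_refl; simpl; ring.
    + destruct (Nat.eqb_spec a a0), (Nat.eqb_spec b b0); simpl; try ring; lia.
  - simpl in Hle |- *; rewrite !ev_add, <- IHe, <- IHf by lia.
    rewrite (dsum_ext _ _ (fun a b =>
        ev X (dvar d a b) p * ev X (diff_var a b e) p
        + ev X (dvar d a b) p * ev X (diff_var a b f) p))
      by (intros; rewrite ev_add; simpl; ring).
    rewrite dsum_plus; ring.
  - simpl in Hle |- *; rewrite !ev_add, !ev_mul, <- IHe, <- IHf by lia.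
    rewrite (dsum_ext _ _ (fun a b =>
        ev X (dvar d a b) p * ev X (diff_var a b e) p * ev X f p
        + ev X (dvar d a b) p * ev X (diff_var a b f) p * ev X e p))
      by (intros; rewrite ev_add, !ev_mul; simpl; ring).
    rewrite dsum_plus, !dsum_scal; ring.
Qed.

(** The double series stops at the order of [e]. Stating the result as an equality of functions is
    what allows it to be iterated. *)
Lemma total_ev d e : total d (ev X e) = ev X (diff_total d e).
Proof.
  extensionality p; rewrite <- (ev_diff_total d e p (order e)) by lia.
  assert (Hb : Derive (fun s => ev X e (set_base d s p)) (base d p)
               = ev X (diff_base d e) p)
    by apply is_derive_unique, is_derive_ev_base.
  rewrite <- Hb; unfold dsum; rewrite <- Series_double_finite.
  - destruct d; simpl; unfold total_x, total_t, pd_x, pd_t; f_equal;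
      apply Series_ext; intros a; apply Series_ext; intros b;
      rewrite pd_u_ev; reflexivity.
  - intros a b H; rewrite diff_var_above_order by assumption; simpl; ring.
Qed.

Lemma iter_total_ev d n e :
  Nat.iter n (total d) (ev X e) = ev X (Nat.iter n (diff_total d) e).
Proof.
  induction n as [|n IH]; simpl; [reflexivity | now rewrite IH, total_ev].
Qed.

Fixpoint esum (f : nat -> dfun) (N : nat) : dfun :=
  match N with
  | O => f O
  | S N' => add (esum f N') (f N)
  end.

Lemma ev_esum f N p : ev X (esum f N) p = sum_f_R0 (fun n => ev X (f n) p) N.
Proof. induction N as [|N IH]; simpl; [reflexivity | now rewrite ev_add, IH]. Qed.

(** The sign is computed in [Z], so that it remains a literal under evaluation. *)
Definition euler_term (e : dfun) (a b : nat) : dfun :=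
  mul (Cst (Nat.iter (a + b) Z.opp 1%Z))
      (Nat.iter a (diff_total dirX) (Nat.iter b (diff_total dirT) (diff_var a b e))).

Definition euler_dfun (e : dfun) : dfun :=
  esum (fun a => esum (euler_term e a) (order e)) (order e).

Lemma ev_euler_term e a b p :
  ev X (euler_term e a b) p =
  (-1) ^ (a + b) * Nat.iter a total_x (Nat.iter b total_t (pd_u a b (ev X e))) p.
Proof.
  unfold euler_term; rewrite ev_mul, pd_u_ev.
  rewrite (iter_total_ev dirT), (iter_total_ev dirX); f_equal; simpl.
  induction (a + b)%nat as [|n IH]; simpl; [reflexivity|].
  rewrite opp_IZR, IH; ring.
Qed.

(** This turns the Euler operator into a term that can be computed by reduction: beyond the order of
    [e] every summand vanishes. *)
Lemma euler_ev e p : euler (ev X e) p = ev X (euler_dfun e) p.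
Proof.
  unfold euler, euler_dfun; rewrite ev_esum, (Series_double_finite _ (order e)).
  - apply sum_eq; intros a _; rewrite ev_esum; apply sum_eq; intros b _.
    symmetry; apply ev_euler_term.
  - intros a b H; rewrite <- ev_euler_term; unfold euler_term.
    rewrite diff_var_above_order by assumption.
    assert (H0 : forall d n, Nat.iter n (diff_total d) (Cst 0) = Cst 0)
      by (intros d n; induction n as [|n IH]; simpl; [|rewrite IH]; reflexivity).
    rewrite !H0, ev_mul; simpl; ring.
Qed.

End Total.

(** * Realization of finitely supported jets *)

(** Divided powers: differentiation lowers the index with no numerical factor, so Taylor
    coefficients are exactly the derivatives at the center. *)
Definition dpow (n : nat) (y : R) : R := y ^ n / INR (fact n).

Lemma is_derive_dpow_S n c y : is_derive (fun s => dpow (S n) (s - c)) y (dpow n (y - c)).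
Proof.
  unfold dpow; rewrite fact_simpl, mult_INR.
  pose proof (INR_fact_neq_0 n); pose proof (pos_INR n).
  generalize dependent (INR (fact n)); intros r Hr.
  auto_derive; [trivial|].
  change (match n with O => 1 | S _ => INR n + 1 end) with (INR (S n)).
  rewrite S_INR; simpl pred; fold (y - c); field; lra.
Qed.

(** Shifting the coefficients but keeping the length [N] adds one top term, which is subtracted. For
    supported coefficients it is zero. *)
Lemma is_derive_taylor_sum (q : nat -> R) (c y : R) (N : nat) :
  is_derive (fun s => sum_f_R0 (fun a => q a * dpow a (s - c)) N) y
            (sum_f_R0 (fun a => q (S a) * dpow a (y - c)) N - q (S N) * dpow N (y - c)).
Proof.
  induction N as [|N IH]; simpl.
  - unfold dpow; simpl; auto_derive; [trivial | field].
  - replace (_ - _) with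
      ((sum_f_R0 (fun a => q (S a) * dpow a (y - c)) N - q (S N) * dpow N (y - c))
       + q (S N) * dpow N (y - c)) by ring.
    apply is_derive_Rplus; [exact IH|].
    apply is_derive_scal, is_derive_dpow_S.
Qed.

Lemma is_derive_sum (f : nat -> R -> R) (d : nat -> R) (y : R) (N : nat) :
  (forall n, is_derive (f n) y (d n)) ->
  is_derive (fun s => sum_f_R0 (fun n => f n s) N) y (sum_f_R0 d N).
Proof.
  intros Hf; induction N as [|N IH]; simpl; [apply Hf | now apply is_derive_Rplus].
Qed.

Section Taylor.

Variables (x0 t0 : R) (N : nat).

(** The Taylor polynomial at [(x0, t0)] with prescribed derivatives [c a b]. The nesting makes it a
    one-variable Taylor sum in [x] whose coefficients are such sums in [t]. *)
Definition tpol (c : nat -> nat -> R) (x t : R) : R :=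
  sum_f_R0 (fun a => sum_f_R0 (fun b => c a b * dpow b (t - t0)) N * dpow a (x - x0)) N.

Definition supported (c : nat -> nat -> R) : Prop :=
  forall a b, (N < a \/ N < b)%nat -> c a b = 0.

Lemma is_derive_tpol_x c x t : supported c ->
  is_derive (fun s => tpol c s t) x (tpol (fun a b => c (S a) b) x t).
Proof.
  intros Hc; unfold tpol.
  replace (sum_f_R0 _ N) with
    (sum_f_R0 (fun a => sum_f_R0 (fun b => c (S a) b * dpow b (t - t0)) N
                        * dpow a (x - x0)) N
     - sum_f_R0 (fun b => c (S N) b * dpow b (t - t0)) N * dpow N (x - x0)).
  - apply (is_derive_taylor_sum (fun a => sum_f_R0 (fun b => c a b * dpow b (t - t0)) N)).
  - rewrite (sum_eq_R0 (fun b => c (S N) b * _)); [ring|].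
    intros b _; rewrite Hc by lia; ring.
Qed.

Lemma is_derive_tpol_t c x t : supported c ->
  is_derive (fun s => tpol c x s) t (tpol (fun a b => c a (S b)) x t).
Proof.
  intros Hc; unfold tpol.
  apply (is_derive_sum (fun a s =>
    sum_f_R0 (fun b => c a b * dpow b (s - t0)) N * dpow a (x - x0))).
  intros a; apply (is_derive_scal_l (K := R_AbsRing) (V := R_NormedModule)
    (fun s => sum_f_R0 (fun b => c a b * dpow b (s - t0)) N)).
  replace (sum_f_R0 _ N) with
    (sum_f_R0 (fun b => c a (S b) * dpow b (t - t0)) N - c a (S N) * dpow N (t - t0))
    by (rewrite (Hc a (S N)) by lia; ring).
  apply is_derive_taylor_sum.
Qed.

Lemma continuity_2d_pt_dpow a (g : R -> R -> R) x t :
  continuity_2d_pt g x t -> continuity_2d_pt (fun x t => dpow a (g x t)) x t.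
Proof.
  intros Hg; apply continuity_1d_2d_pt_comp; [|exact Hg].
  unfold dpow; apply derivable_continuous_pt; reg.
Qed.

Lemma continuity_2d_pt_sum (f : nat -> R -> R -> R) M x t :
  (forall n, continuity_2d_pt (f n) x t) ->
  continuity_2d_pt (fun x t => sum_f_R0 (fun n => f n x t) M) x t.
Proof.
  intros Hf; induction M as [|M IH]; simpl; [apply Hf|].
  now apply continuity_2d_pt_plus.
Qed.

Lemma continuity_2d_pt_tpol c x t : continuity_2d_pt (tpol c) x t.
Proof.
  apply continuity_2d_pt_sum; intros a; apply continuity_2d_pt_mult.
  - apply continuity_2d_pt_sum; intros b; apply continuity_2d_pt_mult.
    + apply continuity_2d_pt_const.
    + apply continuity_2d_pt_dpow, continuity_2d_pt_minus;
        [apply continuity_2d_pt_id2 | apply continuity_2d_pt_const].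
  - apply continuity_2d_pt_dpow, continuity_2d_pt_minus;
      [apply continuity_2d_pt_id1 | apply continuity_2d_pt_const].
Qed.

Lemma supported_shift c m n : supported c -> supported (fun a b => c (m + a)%nat (n + b)%nat).
Proof. intros Hc a b H; apply Hc; lia. Qed.

(** The partial derivatives are again of the form [tpol], with shifted coefficients; the induction
    on [k] is therefore made for all supported [c] at once. *)
Lemma smooth2_tpol c : supported c -> smooth2 (tpol c).
Proof.
  intros Hc k; revert c Hc; induction k as [|k IH]; intros c Hc.
  - split; [intros; apply continuity_2d_pt_tpol | trivial].
  - split; [intros; apply continuity_2d_pt_tpol |].
    split; [|split; [|split]].
    + intros x t; eexists; now apply is_derive_tpol_x.
    + intros x t; eexists; now apply is_derive_tpol_t.
    + replace (fun x t => Derive _ x) with (tpol (fun a b => c (S a) b)).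
      * apply IH; apply (supported_shift c 1 0 Hc).
      * extensionality x; extensionality t; symmetry.
        now apply is_derive_unique, is_derive_tpol_x.
    + replace (fun x t => Derive _ t) with (tpol (fun a b => c a (S b))).
      * apply IH; apply (supported_shift c 0 1 Hc).
      * extensionality x; extensionality t; symmetry.
        now apply is_derive_unique, is_derive_tpol_t.
Qed.

Lemma partial_derive_tpol c m n x t : supported c ->
  partial_derive m n (tpol c) x t = tpol (fun a b => c (m + a)%nat (n + b)%nat) x t.
Proof.
  intros Hc; unfold partial_derive.
  (* [partial_derive] takes the [t]-derivatives inside, so they are computed first, for every value
     of the other variable. *)
  assert (Ht : forall y s, Derive_n (fun z => tpol c y z) n s
                           = tpol (fun a b => c a (n + b)%nat) y s).
  { intros y; induction n as [|n IH]; intros s; [reflexivity|].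
    simpl; rewrite (Derive_ext _ _ _ IH).
    etransitivity.
    { apply is_derive_unique, is_derive_tpol_t, (supported_shift c 0 n Hc). }
    f_equal; extensionality a; extensionality b; f_equal; lia. }
  rewrite (Derive_n_ext _ _ m x (fun y => Ht y t)); clear Ht.
  revert x; induction m as [|m IH]; intros x; [reflexivity|].
  simpl; rewrite (Derive_ext _ _ _ IH).
  etransitivity.
  { apply is_derive_unique, is_derive_tpol_x, (supported_shift c m n Hc). }
  f_equal; extensionality a; extensionality b; f_equal; lia.
Qed.

Lemma tpol_center c : tpol c x0 t0 = c 0%nat 0%nat.
Proof.
  assert (H0 : forall n y, n <> 0%nat -> dpow n (y - y) = 0).
  { intros n y Hn; unfold dpow; rewrite Rminus_diag, pow_i by lia.
    unfold Rdiv; ring. }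
  assert (H1 : forall y, dpow 0 y = 1) by (intros; unfold dpow; simpl; field).
  unfold tpol; rewrite (sum_single N 0), (sum_single N 0), !H1;
    try lia; try ring; intros n Hn; rewrite H0 by assumption; ring.
Qed.

End Taylor.

(** This makes the jet coordinates independent: a condition on all functions [U] may be tested on
    freely chosen finitely supported jets. *)
Lemma finite_jet_realizable (x t : R) (c : nat -> nat -> R) (N : nat) :
  (forall a b, (N < a \/ N < b)%nat -> c a b = 0) ->
  exists U, smooth2 U /\ jet_of U x t = Jet x t c.
Proof.
  intros Hc; exists (tpol x t N c); split; [now apply smooth2_tpol|].
  unfold jet_of; f_equal; extensionality a; extensionality b.
  rewrite partial_derive_tpol by assumption.
  rewrite tpol_center; f_equal; lia.
Qed.

(** * Commuting partial derivatives *)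

Definition part_x (f : R -> R -> R -> R) : R -> R -> R -> R :=
  fun x t u => Derive (fun s => f s t u) x.
Definition part_t (f : R -> R -> R -> R) : R -> R -> R -> R :=
  fun x t u => Derive (fun s => f x s u) t.
Definition part_u (f : R -> R -> R -> R) : R -> R -> R -> R :=
  fun x t u => Derive (fun s => f x t s) u.

Lemma smooth3_parts f : smooth3 f ->
  smooth3 (part_x f) /\ smooth3 (part_t f) /\ smooth3 (part_u f).
Proof.
  intros Hf; repeat split; intros k; apply (Hf (S k)).
Qed.

Lemma smooth3_continuous f x t u : smooth3 f ->
  continuous (fun p : R * R * R => f (fst (fst p)) (snd (fst p)) (snd p)) (x, t, u).
Proof. intros Hf; apply (Hf 0%nat). Qed.

Lemma smooth3_ex_derive f : smooth3 f ->
  (forall x t u, ex_derive (fun s => f s t u) x) /\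
  (forall x t u, ex_derive (fun s => f x s u) t) /\
  (forall x t u, ex_derive (fun s => f x t s) u).
Proof.
  intros Hf; destruct (Hf 1%nat) as (_ & H1 & H2 & H3 & _); auto.
Qed.

Lemma Schwarz_everywhere (f : R -> R -> R) :
  (forall u v, ex_derive (fun z => f z v) u) ->
  (forall u v, ex_derive (fun z => f u z) v) ->
  (forall u v, ex_derive (fun z => Derive (fun t => f z t) v) u) ->
  (forall u v, ex_derive (fun z => Derive (fun t => f t z) u) v) ->
  (forall u v, continuous (fun p => Derive (fun z => Derive (fun t => f z t) (snd p)) (fst p)) (u, v)) ->
  (forall u v, continuous (fun p => Derive (fun z => Derive (fun t => f t z) (fst p)) (snd p)) (u, v)) ->
  forall x y, Derive (fun z => Derive (fun t => f z t) y) x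
              = Derive (fun z => Derive (fun t => f t z) x) y.
Proof.
  intros H1 H2 H3 H4 C1 C2 x y; apply Schwarz.
  (* Differentiability is assumed on the whole plane, so any radius serves. *)
  - exists (mkposreal 1 Rlt_0_1); intros; auto.
  - apply continuity_2d_pt_filterlim, C1.
  - apply continuity_2d_pt_filterlim, C2.
Qed.

Lemma continuous_pair (U V W : UniformSpace) (f : U -> V) (g : U -> W) (x : U) :
  continuous f x -> continuous g x ->
  continuous (fun y => (f y, g y) : prod_UniformSpace V W) x.
Proof.
  intros Hf Hg; apply (continuous_comp_2 f g (@pair V W)); [assumption..|].
  apply continuous_ext with (2 := continuous_id _); now intros [].
Qed.

(** Freezing one variable is composition with a continuous embedding of the plane. This supplies the
    continuity that the two-variable Schwarz theorem asks for. *)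
Lemma smooth3_slices f : smooth3 f ->
  (forall u x t, continuous (fun p : R * R => f (fst p) (snd p) u) (x, t)) /\
  (forall t x u, continuous (fun p : R * R => f (fst p) t (snd p)) (x, u)) /\
  (forall x t u, continuous (fun p : R * R => f x (fst p) (snd p)) (t, u)).
Proof.
  intros Hf.
  assert (H : forall (g : R * R -> R * R * R) q, continuous g q ->
    continuous (fun p => f (fst (fst (g p))) (snd (fst (g p))) (snd (g p))) q).
  { intros g q Hg.
    apply (continuous_comp g
      (fun r : R * R * R => f (fst (fst r)) (snd (fst r)) (snd r))); [exact Hg|].
    destruct (g q) as [[x t] u]; now apply smooth3_continuous. }
  repeat split; intros x t u.
  - apply (H (fun p => ((fst p, snd p), x))).
    repeat apply continuous_pair;
      auto using continuous_fst, continuous_snd, continuous_const.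
  - apply (H (fun p => ((fst p, x), snd p))).
    repeat apply continuous_pair;
      auto using continuous_fst, continuous_snd, continuous_const.
  - apply (H (fun p => ((x, fst p), snd p))).
    repeat apply continuous_pair;
      auto using continuous_fst, continuous_snd, continuous_const.
Qed.

Section Commute.

Variable f : R -> R -> R -> R.
Hypothesis Hf : smooth3 f.

Lemma part_xt : part_x (part_t f) = part_t (part_x f).
Proof.
  destruct (smooth3_parts f Hf) as (Hx & Ht & Hu).
  extensionality x; extensionality t; extensionality u.
  exact (Schwarz_everywhere (fun x t => f x t u)
    (fun a b => (proj1 (smooth3_ex_derive _ Hf)) a b u)
    (fun a b => (proj1 (proj2 (smooth3_ex_derive _ Hf))) a b u)
    (fun a b => (proj1 (smooth3_ex_derive _ Ht)) a b u)
    (fun a b => (proj1 (proj2 (smooth3_ex_derive _ Hx))) a b u)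
    (proj1 (smooth3_slices _ (proj1 (smooth3_parts _ Ht))) u)
    (proj1 (smooth3_slices _ (proj1 (proj2 (smooth3_parts _ Hx)))) u)
    x t).
Qed.

Lemma part_xu : part_x (part_u f) = part_u (part_x f).
Proof.
  destruct (smooth3_parts f Hf) as (Hx & Ht & Hu).
  extensionality x; extensionality t; extensionality u.
  exact (Schwarz_everywhere (fun x u => f x t u)
    (fun a b => (proj1 (smooth3_ex_derive _ Hf)) a t b)
    (fun a b => (proj2 (proj2 (smooth3_ex_derive _ Hf))) a t b)
    (fun a b => (proj1 (smooth3_ex_derive _ Hu)) a t b)
    (fun a b => (proj2 (proj2 (smooth3_ex_derive _ Hx))) a t b)
    (proj1 (proj2 (smooth3_slices _ (proj1 (smooth3_parts _ Hu)))) t)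
    (proj1 (proj2 (smooth3_slices _ (proj2 (proj2 (smooth3_parts _ Hx))))) t)
    x u).
Qed.

Lemma part_tu : part_t (part_u f) = part_u (part_t f).
Proof.
  destruct (smooth3_parts f Hf) as (Hx & Ht & Hu).
  extensionality x; extensionality t; extensionality u.
  exact (Schwarz_everywhere (fun t u => f x t u)
    (fun a b => (proj1 (proj2 (smooth3_ex_derive _ Hf))) x a b)
    (fun a b => (proj2 (proj2 (smooth3_ex_derive _ Hf))) x a b)
    (fun a b => (proj1 (proj2 (smooth3_ex_derive _ Hu))) x a b)
    (fun a b => (proj2 (proj2 (smooth3_ex_derive _ Ht))) x a b)
    (proj2 (proj2 (smooth3_slices _ (proj1 (proj2 (smooth3_parts _ Hu))))) x)
    (proj2 (proj2 (smooth3_slices _ (proj2 (proj2 (smooth3_parts _ Ht))))) x)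
    t u).
Qed.

End Commute.

Definition partials (f : R -> R -> R -> R) (i j k : nat) : R -> R -> R -> R :=
  Nat.iter i part_x (Nat.iter j part_t (Nat.iter k part_u f)).

(** The invariant [P] will be smoothness, since partial derivatives are only known to commute on
    smooth functions. *)
Lemma iter_preserves_commutes (T : Type) (P : T -> Prop) (A B : T -> T) :
  (forall f, P f -> P (A f)) -> (forall f, P f -> P (B f)) ->
  (forall f, P f -> A (B f) = B (A f)) ->
  forall n f, P f -> P (Nat.iter n A f) /\ Nat.iter n A (B f) = B (Nat.iter n A f).
Proof.
  intros HA HB HAB n f Hf; induction n as [|n [IH1 IH2]]; simpl; auto.
  split; [auto | rewrite IH2; auto].
Qed.

(** In [partials] the [x]-derivatives are outermost, so raising [i] is immediate. A new derivative
    in [t] or [u] has to be moved inward past the iterates already present. *)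
Lemma partials_coherent_smooth3 f : smooth3 f -> partials_coherent (partials f).
Proof.
  intros Hf i j k x t u.
  pose proof (fun g Hg => proj1 (smooth3_parts g Hg)) as Px.
  pose proof (fun g Hg => proj1 (proj2 (smooth3_parts g Hg))) as Pt.
  pose proof (fun g Hg => proj2 (proj2 (smooth3_parts g Hg))) as Pu.
  (* Taking both operators equal to [part_u] makes the commutation trivial and leaves the
     preservation of smoothness. *)
  assert (Hk : smooth3 (Nat.iter k part_u f))
    by now apply (iter_preserves_commutes _ smooth3 part_u part_u).
  destruct (iter_preserves_commutes _ smooth3 part_t part_u Pt Pu part_tu j _ Hk)
    as [Hj Htu].
  destruct (iter_preserves_commutes _ smooth3 part_x part_u Px Pu part_xu i _ Hj)
    as [Hi Hxu].
  destruct (iter_preserves_commutes _ smooth3 part_x part_t Px Pt part_xt i _ Hj)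
    as [_ Hxt].
  destruct (smooth3_ex_derive _ Hi) as (D1 & D2 & D3).
  unfold partials; simpl; rewrite Htu, Hxu, Hxt.
  split; [exact (Derive_correct _ _ (D1 x t u)) |].
  split; [exact (Derive_correct _ _ (D2 x t u)) | exact (Derive_correct _ _ (D3 x t u))].
Qed.

(** * Multipliers of the higher order Camassa-Holm equation *)

Definition hoch_multiple : dfun :=
  let c z e := Mul (Cst z) e in
  let u a := Var a 0%nat in
  Mul (Par 0%nat 0%nat 0%nat)
    (Add (Add (Add (Var 0%nat 1%nat) (c (-1)%Z (Var 2%nat 1%nat))) (Var 4%nat 1%nat))
    (Add (Add (c 3%Z (Mul (u 0%nat) (u 1%nat))) (c (-2)%Z (Mul (u 1%nat) (u 2%nat))))
    (Add (c (-1)%Z (Mul (u 0%nat) (u 3%nat)))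
    (Add (c 2%Z (Mul (u 1%nat) (u 4%nat))) (Mul (u 0%nat) (u 5%nat)))))).

Lemma euler_hoch_multiple (xi : R -> R -> R -> R) (p : jet) : smooth3 xi ->
  euler (fun j => xi (jx j) (jt j) (ju j 0%nat 0%nat) * HOCH j) p
  = ev (partials xi) (euler_dfun hoch_multiple) p.
Proof.
  intros Hxi; rewrite <- euler_ev by now apply partials_coherent_smooth3.
  f_equal; extensionality j; unfold HOCH; simpl; unfold partials; simpl; ring.
Qed.

(** * Evaluation at sparse jets *)

(** The support depends on the indices alone, so the pruning can be computed while the values of the
    coordinates stay symbolic. *)
Definition jet_support (l : list (nat * nat)) (a b : nat) : bool :=
  List.existsb (fun q => andb (Nat.eqb a (fst q)) (Nat.eqb b (snd q))) l.

Definition jet_coords (l : list (nat * nat * R)) (a b : nat) : R :=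
  List.fold_right (fun q s =>
    if andb (Nat.eqb a (fst (fst q))) (Nat.eqb b (snd (fst q))) then snd q else s) 0 l.

Lemma jet_coords_zero l a b :
  jet_support (List.map fst l) a b = false -> jet_coords l a b = 0.
Proof.
  induction l as [|[[a' b'] c] l IH]; simpl; [reflexivity|].
  destruct (andb (Nat.eqb a a') (Nat.eqb b b')); simpl; [discriminate | exact IH].
Qed.

Lemma jet_coords_bounded l : exists N, forall a b,
  (N < a \/ N < b)%nat -> jet_coords l a b = 0.
Proof.
  induction l as [|[[a' b'] c] l [N IH]]; [now exists 0%nat|].
  exists (Nat.max N (Nat.max a' b')); intros a b H; simpl.
  destruct (Nat.eqb_spec a a'), (Nat.eqb_spec b b'); simpl; try apply IH; lia.
Qed.

(* Discarding the atoms that vanish at a sparse jet, or identically, before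
   evaluating keeps the formula for the Euler operator small. *)
Lemma multiplier_at_jet xi kX l x t :
  smooth3 xi -> local_multiplier HOCH xi ->
  (forall i j k, kX i j k = false -> forall x t u, partials xi i j k x t u = 0) ->
  ev (partials xi)
     (subst_zero kX (jet_support (List.map fst l)) (euler_dfun hoch_multiple))
     (Jet x t (jet_coords l)) = 0.
Proof.
  intros Hxi Hm HX; rewrite ev_subst_zero.
  - destruct (jet_coords_bounded l) as [N HN].
    destruct (finite_jet_realizable x t _ N HN) as (U & HU & <-).
    rewrite <- euler_hoch_multiple by assumption; now apply Hm.
  - intros i j k Hk; now apply HX.
  - apply jet_coords_zero.
Qed.

(** Only the pruned expression is normalized by [vm_compute]; [cbn] then evaluates it at the sparse
    jet, leaving an equation between partial derivatives for [lra]. *)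
Ltac compute_subst_zero H :=
  match type of H with
  | context [subst_zero ?kX ?kV ?e] =>
      let r := eval vm_compute in (subst_zero kX kV e) in
      replace (subst_zero kX kV e) with r in H by (vm_compute; reflexivity)
  end;
  cbn [ev jx jt ju jet_coords List.fold_right Nat.eqb andb fst snd] in H.

(** * Consequences of relations between partial derivatives *)

(** A proportionality valid everywhere may be differentiated in each direction. The case [c = 0]
    propagates vanishing, and [c = 1] propagates equality. *)
Lemma coherent_ext X i j k i' j' k' c : partials_coherent X ->
  (forall x t u, X i j k x t u = c * X i' j' k' x t u) ->
  (forall x t u, X (S i) j k x t u = c * X (S i') j' k' x t u) /\
  (forall x t u, X i (S j) k x t u = c * X i' (S j') k' x t u) /\
  (forall x t u, X i j (S k) x t u = c * X i' j' (S k') x t u).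
Proof.
  intros HX H; split; [|split]; intros x t u;
  destruct (HX i j k x t u) as (A1 & A2 & A3);
  destruct (HX i' j' k' x t u) as (B1 & B2 & B3).
  - apply (is_derive_scal _ _ c) in B1.
    apply is_derive_unique in A1, B1; rewrite <- A1; etransitivity; [|exact B1].
    apply Derive_ext; intros; apply H.
  - apply (is_derive_scal _ _ c) in B2.
    apply is_derive_unique in A2, B2; rewrite <- A2; etransitivity; [|exact B2].
    apply Derive_ext; intros; apply H.
  - apply (is_derive_scal _ _ c) in B3.
    apply is_derive_unique in A3, B3; rewrite <- A3; etransitivity; [|exact B3].
    apply Derive_ext; intros; apply H.
Qed.

Lemma coherent_vanish X i j k : partials_coherent X ->
  (forall x t u, X i j k x t u = 0) ->
  forall i' j' k', (i <= i')%nat -> (j <= j')%nat -> (k <= k')%nat ->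
  forall x t u, X i' j' k' x t u = 0.
Proof.
  intros HX H.
  assert (step : forall i j k, (forall x t u, X i j k x t u = 0) ->
    (forall x t u, X (S i) j k x t u = 0) /\
    (forall x t u, X i (S j) k x t u = 0) /\
    (forall x t u, X i j (S k) x t u = 0)).
  { clear - HX; intros i j k H.
    destruct (coherent_ext X i j k i j k 0 HX) as (H1 & H2 & H3).
    - intros; rewrite H; ring.
    - split; [|split]; intros; [rewrite H1 | rewrite H2 | rewrite H3]; ring. }
  intros i' j' k' Hi Hj Hk.
  induction Hi as [|i' Hi IH]; [|now apply step].
  induction Hj as [|j' Hj IH]; [|now apply step].
  induction Hk as [|k' Hk IH]; [exact H | now apply step].
Qed.

Lemma constant_of_zero_derivative (f : R -> R) :
  (forall x, is_derive f x 0) -> forall x y, f x = f y.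
Proof.
  intros Hf x y; destruct (MVT_gen f x y (fun _ => 0)) as (z & _ & Hz).
  - intros; apply Hf.
  - intros z _; apply continuity_pt_filterlim.
    apply (ex_derive_continuous (K := R_AbsRing) (V := R_NormedModule)).
    eexists; apply Hf.
  - lra.
Qed.

Lemma affine_of_constant_derivative (f : R -> R) (c : R) :
  (forall x, is_derive f x c) -> forall x, f x = c * x + f 0.
Proof.
  intros Hf x.
  pose proof (constant_of_zero_derivative (fun s => f s + - c * s)) as H.
  assert (Hd : forall y, is_derive (fun s => f s + - c * s) y 0).
  { intros y; replace 0 with (c + - c * 1) by ring.
    apply is_derive_Rplus; [apply Hf|].
    apply is_derive_scal, (is_derive_id (K := R_AbsRing)). }
  specialize (H Hd x 0); simpl in H; lra.
Qed.

(** * Determining equations for the multiplier *)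

Lemma multiplier_linear xi : smooth3 xi -> local_multiplier HOCH xi ->
  (forall x t u, partials xi 1 0 1 x t u = 0) /\
  (forall x t u, partials xi 0 0 2 x t u = 0).
Proof.
  intros Hxi Hm.
  assert (H : forall x t u v,
    partials xi 1 0 1 x t u + v * partials xi 0 0 2 x t u = 0).
  { intros x t u v.
    (* The free coordinates are [U = u], [U_x = v] and [U_xxxt = s]. The expression is affine in
       [s], so comparing [s = 0] with [s = 1] extracts the coefficient of [U_xxxt]. *)
    assert (H := fun s => multiplier_at_jet xi (fun _ _ _ => true)
      (((0, 0)%nat, u) :: ((1, 0)%nat, v) :: ((3, 1)%nat, s) :: nil)%list x t Hxi Hm
      ltac:(discriminate)).
    pose proof (H 0) as H0; pose proof (H 1) as H1; clear H.
    cbn [List.map fst] in H0, H1; compute_subst_zero H0; compute_subst_zero H1.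
    lra. }
  (* The relation is affine in [v]; the values 0 and 1 separate its two coefficients. *)
  split; intros x t u; pose proof (H x t u 0); pose proof (H x t u 1); lra.
Qed.

Lemma multiplier_x_of_tu xi : smooth3 xi -> local_multiplier HOCH xi ->
  forall x t u, partials xi 1 0 0 x t u = partials xi 0 1 1 x t u.
Proof.
  intros Hxi Hm; destruct (multiplier_linear xi Hxi Hm) as [Hxu Huu].
  pose proof (partials_coherent_smooth3 xi Hxi) as HX.
  (* For [xi] of the form [a(t) U + b(x,t)], two derivatives in [U], or one in [U] and one in [x],
     give zero. *)
  assert (Hk : forall i j k,
    match i, k with _, 0 | 0, 1 => true | _, _ => false end%nat = false ->
    forall x t u, partials xi i j k x t u = 0).
  { intros [|i] j [|[|k]]; try discriminate; intros _.
    - apply (coherent_vanish _ 0 0 2 HX Huu); lia.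
    - apply (coherent_vanish _ 1 0 1 HX Hxu); lia.
    - apply (coherent_vanish _ 1 0 1 HX Hxu); lia. }
  intros x t u.
  (* With [U_x = 0], the coefficient of [U_xxxx] reduces to [xi_x - xi_tU]. *)
  assert (H := fun s => multiplier_at_jet xi _ (((0, 0)%nat, u) :: ((4, 0)%nat, s) :: nil)%list
    x t Hxi Hm Hk).
  pose proof (H 0) as H0; pose proof (H 1) as H1; clear H Hk.
  cbn [List.map fst] in H0, H1; compute_subst_zero H0; compute_subst_zero H1.
  lra.
Qed.

Lemma multiplier_first_order xi : smooth3 xi -> local_multiplier HOCH xi ->
  (forall x t u, partials xi 1 0 0 x t u = 0) /\
  (forall x t u, partials xi 0 1 0 x t u = 0).
Proof.
  intros Hxi Hm; destruct (multiplier_linear xi Hxi Hm) as [Hxu Huu].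
  pose proof (partials_coherent_smooth3 xi Hxi) as HX.
  pose proof (multiplier_x_of_tu xi Hxi Hm) as Hxtu.
  assert (Hx1 : forall x t u, partials xi 1 0 0 x t u = 1 * partials xi 0 1 1 x t u)
    by (intros; rewrite Hxtu; ring).
  destruct (coherent_ext _ 1 0 0 0 1 1 1 HX Hx1) as (Hxx & Hxt & _).
  (* Differentiating [xi_x = xi_tU] in [x] gives [xi_xx = xi_xtU], which vanishes because [xi_xU]
     does. *)
  assert (Hxx0 : forall x t u, partials xi 2 0 0 x t u = 0).
  { intros; rewrite Hxx, (coherent_vanish _ 1 0 1 HX Hxu) by lia; ring. }
  assert (Hk : forall i j k,
    match i, k with 0, 0 | 0, 1 | 1, 0 => true | _, _ => false end%nat = false ->
    forall x t u, partials xi i j k x t u = 0).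
  { intros [|[|i]] j [|[|k]]; try discriminate; intros _;
      first [ apply (coherent_vanish _ 0 0 2 HX Huu); lia
            | apply (coherent_vanish _ 1 0 1 HX Hxu); lia
            | apply (coherent_vanish _ 2 0 0 HX Hxx0); lia ]. }
  assert (H := fun s x t u =>
    multiplier_at_jet xi _ (((0, 0)%nat, u) :: ((2, 0)%nat, s) :: nil)%list
      x t Hxi Hm Hk).
  (* The coefficient of [U_xx] gives [xi_x + xi_tU = 0]; together with [xi_x = xi_tU] this forces
     both to vanish. *)
  assert (Hx0 : forall x t u, partials xi 1 0 0 x t u = 0).
  { intros x t u; specialize (Hxtu x t u).
    pose proof (H 0 x t u) as H0; pose proof (H 1 x t u) as H1.
    cbn [List.map fst] in H0, H1; compute_subst_zero H0; compute_subst_zero H1.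
    lra. }
  split; [exact Hx0 | intros x t u].
  assert (Htu0 : partials xi 0 1 1 x t u = 0) by (rewrite <- Hxtu; apply Hx0).
  specialize (Hx0 x t u).
  (* When [U_xx = 0] as well, the Euler expression has the value [- xi_t - 3 U xi_x]. The product is
     nonlinear for [lra], so [xi_x = 0] is substituted first. *)
  pose proof (H 0 x t u) as H0.
  cbn [List.map fst] in H0; compute_subst_zero H0.
  rewrite Hx0 in H0; lra.
Qed.

(** For affine [xi] only [xi] and [xi_U] survive. Once they are replaced by [c1 * u + c2] and [c1],
    the Euler expression is a polynomial in the jet coordinates that cancels identically. *)
Lemma affine_multiplier xi c1 c2 : smooth3 xi ->
  (forall x t u, xi x t u = c1 * u + c2) -> local_multiplier HOCH xi.
Proof.
  intros Hxi Haff U HU x t; rewrite euler_hoch_multiple by assumption.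
  pose proof (partials_coherent_smooth3 xi Hxi) as HX.
  assert (H0 : forall x t u, partials xi 0 0 0 x t u = c1 * u + c2) by exact Haff.
  assert (Hder : forall f d y, is_derive f y d -> (forall s : R, f s = f y) -> d = 0).
  { intros f d y Hd Hf; rewrite <- (is_derive_unique _ _ _ Hd).
    rewrite (Derive_ext _ (fun _ => f y)) by exact Hf; apply Derive_const. }
  assert (H1 : forall x t u, partials xi 1 0 0 x t u = 0).
  { intros; eapply Hder; [apply HX | intros; cbv beta; rewrite !H0; reflexivity]. }
  assert (H2 : forall x t u, partials xi 0 1 0 x t u = 0).
  { intros; eapply Hder; [apply HX | intros; cbv beta; rewrite !H0; reflexivity]. }
  assert (H3 : forall x t u, partials xi 0 0 1 x t u = c1).
  { intros y s u; destruct (HX 0%nat 0%nat 0%nat y s u) as (_ & _ & D).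
    rewrite <- (is_derive_unique _ _ _ D).
    rewrite (Derive_ext _ (fun v => c1 * v + c2)) by apply H0.
    apply is_derive_unique; auto_derive; [trivial | ring]. }
  assert (H4 : forall x t u, partials xi 0 0 2 x t u = 0).
  { intros; eapply Hder; [apply HX | intros; cbv beta; rewrite !H3; reflexivity]. }
  (* Every jet coordinate is kept, since the jet comes from an arbitrary [U]; only partial
     derivatives of [xi] are discarded. *)
  rewrite <- (ev_subst_zero _
    (fun i j k => match i, j, k with 0, 0, 0 | 0, 0, 1 => true | _, _, _ => false end%nat)
    (fun _ _ => true)); [| |discriminate].
  - match goal with |- context [subst_zero ?kX ?kV ?e] =>
      let r := eval vm_compute in (subst_zero kX kV e) in
      replace (subst_zero kX kV e) with r by (vm_compute; reflexivity)
    end.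
    cbn [ev]; rewrite H0, H3; ring.
  - intros [|i] [|j] [|[|k]]; try discriminate; intros _;
      first [ apply (coherent_vanish _ 1 0 0 HX H1); lia
            | apply (coherent_vanish _ 0 1 0 HX H2); lia
            | apply (coherent_vanish _ 0 0 2 HX H4); lia ].
Qed.

Theorem mainTheorem4 (xi : R -> R -> R -> R) (hxi : smooth3 xi) :
  local_multiplier HOCH xi <->
  exists c1 c2 : R, forall x t u : R, xi x t u = c1 * u + c2.
Proof.
  split; [intros Hm | intros (c1 & c2 & H); now apply (affine_multiplier xi c1 c2)].
  destruct (multiplier_linear xi hxi Hm) as [_ Huu].
  destruct (multiplier_first_order xi hxi Hm) as [Hx Ht].
  pose proof (partials_coherent_smooth3 xi hxi) as HX.
  (* The constants are [xi_U] and [xi] at the origin. The value [xi x t u] is carried to [xi 0 0 u]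
     along an [x]-line and a [t]-line, on which [xi] is constant, and [xi 0 0] is affine because its
     derivative is constant. *)
  exists (partials xi 0 0 1 0 0 0), (xi 0 0 0); intros x t u.
  assert (Hu : forall v, is_derive (fun s => xi 0 0 s) v (partials xi 0 0 1 0 0 0)).
  { intros v.
    rewrite (constant_of_zero_derivative (fun s => partials xi 0 0 1 0 0 s)) with (y := v).
    - apply (HX 0%nat 0%nat 0%nat).
    - intros w; destruct (HX 0%nat 0%nat 1%nat 0 0 w) as (_ & _ & D).
      rewrite Huu in D; exact D. }
  rewrite (constant_of_zero_derivative (fun s => xi s t u)) with (y := 0).
  2:{ intros s; destruct (HX 0%nat 0%nat 0%nat s t u) as (D & _ & _).
      rewrite Hx in D; exact D. }
  rewrite (constant_of_zero_derivative (fun s => xi 0 s u)) with (y := 0).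
  2:{ intros s; destruct (HX 0%nat 0%nat 0%nat 0 s u) as (_ & D & _).
      rewrite Ht in D; exact D. }
  exact (affine_of_constant_derivative _ _ Hu u).
Qed.
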